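(* Let $r_j,\delta_j,m_j$ ($j\in[s]$) be positive integers, $n_j=m_j(r_j+\delta_j-1)$, $n=\sum_{j=1}^s n_j$, and let $\mathscr{C}$ be the linear code over $\mathbb{F}_{q^t}$ of length $n$ obtained by the Gabidulin-based construction described in the context with $k=n_{\mathrm{Gab}}=\sum_{j=1}^s m_jr_j\le t$. Then $\mathscr{C}$ has $\{(n_j,r_j,\delta_j)\}_{j\in[s]}$-locality and its dimension attains with equality the upper bound $k\le\sum_{j=1}^s k_j$ valid for all linear codes with $\{(n_j,r_j,\delta_j)\}_{j\in[s]}$-locality, where $k_j$ is defined in the context.
   Context: For an integer $i$, $[i]=\{1,\dots,i\}$. An $[n,k,d]_{q}$ code is a linear code over $\mathbb{F}_q$ of length $n$, dimension $k$ and minimum Hamming distance $d$. MDS codes are linear codes with $d=n-k+1$. Gabidulin code: for $t\ge N\ge k$, an $[N,k]_{q^t}$ Gabidulin code encodes a message $(a_1,\dots,a_k)\in\mathbb{F}_{q^t}^k$ as $(f(x_1),\dots,f(x_N))$, where $f(x)=\sum_{i=1}^k a_i x^{q^{i-1}}$ and $x_1,\dots,x_N\in\mathbb{F}_{q^t}$ are fixed points linearly independent over $\mathbb{F}_q$. Locality: given a partition $[n]=\bigsqcup_{j=1}^s\mathcal{N}_j$ with $|\mathcal{N}_j|=n_j$, a linear code $\mathscr{C}$ of length $n$ has $\{(n_j,r_j,\delta_j)\}_{j\in[s]}$-locality if for every $j\in[s]$ and $i\in\mathcal{N}_j$ there is $\mathcal{S}_i\subset\mathcal{N}_j$ with $i\in\mathcal{S}_i$,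 $|\mathcal{S}_i|\le r_j+\delta_j-1$ and $d(\mathscr{C}|_{\mathcal{S}_i})\ge\delta_j$, where $\mathscr{C}|_{\mathcal{S}_i}$ is the restriction of $\mathscr{C}$ to the coordinates in $\mathcal{S}_i$. Construction: assume $k\le n_{\mathrm{Gab}}:=\sum_{j=1}^s m_jr_j\le t$. (1) Precode $k$ information symbols (in $\mathbb{F}_{q^t}$) using a Gabidulin code of length $n_{\mathrm{Gab}}$. (2) Partition the Gabidulin codeword symbols into $\sum_{j=1}^s m_j$ local groups, with exactly $m_j$ groups of size $r_j$ for each $j\in[s]$. (3) Encode each local group of size $r_j$ (as a row vector, multiplied by the generator matrix) using an $[r_j+\delta_j-1,r_j,\delta_j]_q$ MDS code (over $\mathbb{F}_q$; such MDS codes are assumed to be given). The codeword is the concatenation of all encoded local groups, and $\mathcal{N}_j$ is the set of coordinates belonging to the $m_j$ encoded groups of type $j$. Definition of $k_j$: with $n_j=p_j(r_j+\delta_j-1)+q_j$, $0\le q_j\le r_j+\delta_j-2$ ($p_j,q_j$ integers) and $m_j=n_j/(r_j+\delta_j-1)$, $k_j=\lfloor m_j\rfloor r_j$ if $0\le q_j\le\delta_j-2$ and $k_j=n_j-\lceil m_j\rceil(\delta_j-1)$ if $\delta_j-1\le q_j\le r_j+\delta_j-2$. *)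

(* Defs.v *)
From HB Require Import structures.
From mathcomp Require Import all_boot all_order all_algebra all_fingroup all_field.

Set Implicit Arguments.
Unset Strict Implicit.
Unset Printing Implicit Defensive.

Import GRing.Theory.
Local Open Scope ring_scope.

Section LinearCodes.
Variable K : fieldType.

Definition hamming_dist n (u v : 'rV[K]_n) : nat := #|[set i | u 0 i != v 0 i]|.

(* A code with a single word has infinite minimum distance: [min_dist_ge]
   then holds for every [d]. *)
Definition min_dist_ge n (C : {vspace 'rV[K]_n}) (d : nat) : Prop :=
  forall u v, u \in C -> v \in C -> u != v -> (d <= hamming_dist u v)%N.

Definition has_min_dist n (C : {vspace 'rV[K]_n}) (d : nat) : Prop :=
  min_dist_ge C d /\
  exists u v, [/\ u \in C, v \in C, u != v & hamming_dist u v = d].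

Definition is_code n (C : {vspace 'rV[K]_n}) (k d : nat) : Prop :=
  \dim C = k /\ has_min_dist C d.

Definition is_MDS n (C : {vspace 'rV[K]_n}) (k d : nat) : Prop :=
  is_code C k d /\ d = (n - k + 1)%N.

Definition row_code k n (G : 'M[K]_(k, n)) : {vspace 'rV[K]_n} :=
  <<[seq row i G | i : 'I_k]>>%VS.

Definition restrict_code n (S : {set 'I_n}) (C : {vspace 'rV[K]_n}) :
    {vspace 'rV[K]_#|S|} :=
  (linfun (colsub (@enum_val _ (mem S))) @: C)%VS.

(* The first two clauses say that [N] is the given partition of the coordinates,
   with parts of sizes [n_]. *)
Definition has_locality n s (N : 'I_s -> {set 'I_n})
    (n_ r delta : 'I_s -> nat) (C : {vspace 'rV[K]_n}) : Prop :=
  [/\ forall i, exists! j, i \in N j,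
      forall j, #|N j| = n_ j
    & forall j i, i \in N j ->
        exists S : {set 'I_n},
          [/\ S \subset N j, i \in S, (#|S| <= r j + delta j - 1)%N
            & min_dist_ge (restrict_code S C) (delta j)]].

End LinearCodes.

(* With n = p (r + delta - 1) + q, the quotient n / (r + delta - 1) has floor p
   and ceiling p + (q != 0). The test q <= delta - 2 is written q + 2 <= delta,
   since truncated subtraction would give the wrong answer for delta = 1. *)
Definition local_dim (n r delta : nat) : nat :=
  let p := (n %/ (r + delta - 1))%N in
  let q := (n %% (r + delta - 1))%N in
  if (q + 2 <= delta)%N then (p * r)%N
  else (n - (p + (q != 0)) * (delta - 1))%N.

(* The coordinates of the j-th block, when [n] with n = \sum_j n_j is cut into
   consecutive blocks of lengths n_j. *)
Definition block_coords s (n_ : 'I_s -> nat) (j : 'I_s) :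
    {set 'I_(\sum_(i < s) n_ i)} :=
  [set i | tagnat.sig1 i == j].

Section Construction.
Variables (F : finFieldType) (L : fieldExtType F).

Definition gab_poly k (a : 'rV[L]_k) : {poly L} :=
  \sum_(i < k) a 0 i *: 'X^(#|F| ^ i).

Definition gab_encode k N (x : N.-tuple L) (a : 'rV[L]_k) : 'rV[L]_N :=
  \row_i (gab_poly a).[tnth x i].

Variables (s : nat) (r delta m : 'I_s -> nat) (k : nat).
Variable x : (\sum_(j < s) m j * r j).-tuple L.
Variable pi : 'S_(\sum_(j < s) m j * r j).
Variable G : forall j : 'I_s, 'I_(m j) -> 'M[F]_(r j, r j + delta j - 1).

(* Row l is the l-th local group of type j. The permutation [pi] accounts for
   an arbitrary ordered partition of the Gabidulin symbols into local groups. *)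
Definition local_groups (c : 'rV[L]_(\sum_(j < s) m j * r j)) (j : 'I_s) :
    'M[L]_(m j, r j) :=
  vec_mx (submxrow (col_perm pi c) j).

(* [mxvec] is row-major, hence concatenates the rows, i.e. the encoded local
   groups of type j; [\mxrow] then concatenates over j. *)
Definition lrc_encode (a : 'rV[L]_k) :
    'rV[L]_(\sum_(j < s) m j * (r j + delta j - 1)) :=
  \mxrow_(j < s) mxvec (\matrix_(l < m j)
    (row l (local_groups (gab_encode x a) j) *m map_mx (in_alg L) (G l))).

Fact gab_encode_is_linear N (y : N.-tuple L) : linear (@gab_encode k N y).
Proof.
move=> b u v; apply/rowP=> i; rewrite !mxE /gab_poly -hornerZ -hornerD.
congr (_.[_]); rewrite scaler_sumr -big_split /=; apply: eq_bigr => l _.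
by rewrite !mxE scalerDl scalerA.
Qed.

Fact lrc_encode_is_linear : linear lrc_encode.
Proof.
move=> b u v; rewrite /lrc_encode gab_encode_is_linear; apply/rowP=> i; rewrite !mxE.
case/mxvec_indexP: (tagnat.sig2 i) => l c; rewrite !mxvecE.
rewrite !mxE mulr_sumr -big_split /=; apply: eq_bigr => d _.
by rewrite !mxE mulrDl mulrA.
Qed.

HB.instance Definition _ :=
  GRing.isLinear.Build L 'rV[L]_k
    'rV[L]_(\sum_(j < s) m j * (r j + delta j - 1)) *:%R lrc_encode
    lrc_encode_is_linear.

Definition lrc_code : {vspace 'rV[L]_(\sum_(j < s) m j * (r j + delta j - 1))} :=
  limg (linfun lrc_encode).

End Construction.

(* Main.v *)
Require Import Defs.
From mathcomp Require Import all_boot all_order all_algebra all_fingroup all_field.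
From mathcomp Require Import zify.

Set Implicit Arguments.
Unset Strict Implicit.
Unset Printing Implicit Defensive.

Import GRing.Theory.
Local Open Scope ring_scope.

(** The Gabidulin encoding is injective by root counting (a linearized
    polynomial of q-degree < N has too few roots to vanish on the F-span of N
    independent points), and each local encoding is injective and keeps its
    distance over L, because full rank of submatrices of the generator matrix is
    preserved by extension of scalars; this gives the dimension and the locality.

    For the upper bound, N_j is covered greedily by recovering sets S. A set S
    contributing D new coordinates costs max(0, D - (delta - 1)) information
    coordinates, at most D r / (r + delta - 1) since D <= r + delta - 1. As
    r + delta - 1 divides n_j, summing over the steps yields exactly m_j r_j. *)

(** By linearity a distance is the weight of a difference, so the condition can be tested on the
    words of [C] in their own coordinates, without reindexing by [S]. *)
Lemma min_dist_ge_restrictP (K : fieldType) n (S : {set 'I_n})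
    (C : {vspace 'rV[K]_n}) d :
  min_dist_ge (restrict_code S C) d <->
  forall c, c \in C -> (#|[set i in S | c 0 i != 0]%R| < d)%N ->
    forall i, i \in S -> c 0 i = 0.
Proof.
have entry (c : 'rV[K]_n) (l : 'I_#|S|) : linfun (colsub (@enum_val _ (mem S))) c 0 l
    = c 0 (enum_val l) by rewrite lfunE /= mxE.
have dist (c c' : 'rV[K]_n) : hamming_dist (linfun (colsub (@enum_val _ (mem S))) c)
    (linfun (colsub (@enum_val _ (mem S))) c') =
    #|[set i in S | (c - c') 0 i != 0]|.
  rewrite /hamming_dist -(card_imset _ (@enum_val_inj _ (mem S))).
  apply: eq_card => i; apply/imsetP/idP => [[l + ->]|].
    by rewrite !inE !entry enum_valP !mxE subr_eq0.
  rewrite !inE => /andP[iS ne]; exists (enum_rank_in iS i).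
    by rewrite !inE !entry enum_rankK_in // -subr_eq0; move: ne; rewrite !mxE.
  by rewrite enum_rankK_in.
split=> [dmin c cC wt i iS | H _ _ /memv_imgP[u uC ->] /memv_imgP[v vC ->] ne].
  have := dmin _ _ (memv_img (linfun (colsub (@enum_val _ (mem S)))) cC)
    (mem0v (restrict_code S C)).
  rewrite -[X in hamming_dist _ X](linear0 (linfun (colsub (@enum_val _ (mem S))))).
  rewrite dist subr0 => dle.
  apply/eqP/contraT => ci0; suff /dle: linfun (colsub (@enum_val _ (mem S))) c != 0.
    by rewrite leqNgt wt.
  apply: contraNneq ci0 => /rowP/(_ (enum_rank_in iS i)).
  by rewrite entry enum_rankK_in // mxE => ->.
rewrite dist leqNgt; apply: contra ne => wt.
apply/eqP/rowP=> l; rewrite !entry; apply/eqP; rewrite -subr_eq0; apply/eqP.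
have := H _ (memvB uC vC) wt _ (enum_valP l); by rewrite !mxE.
Qed.

(** * Generator matrices and extension of scalars *)

Section RowCode.
Variables (F : fieldType) (k n : nat) (G : 'M[F]_(k, n)).

Lemma mulmx_row_code (v : 'rV_k) : v *m G \in row_code G.
Proof.
rewrite mulmx_sum_row; apply: memv_suml => i _; apply: memvZ.
by apply: memv_span; apply: image_f.
Qed.

(** The row code lies in the image of [v |-> v *m G], which thus has dimension at least [k];
    rank-nullity leaves no kernel. *)
Lemma row_code_row_free : \dim (row_code G) = k -> row_free G.
Proof.
move=> dimG; set f := linfun (mulmxr G : 'rV_k -> 'rV_n).
have sub : (row_code G <= limg f)%VS.
  apply/span_subvP=> _ /imageP[i _ ->].
  by rewrite rowE -[_ *m G]/(mulmxr G _) -lfunE memv_img ?memvf.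
have ker0 : lker f == 0%VS.
  have := limg_ker_dim f fullv; rewrite capfv dimvf dim_matrix mul1r.
  have := dimvS sub; rewrite dimG -dimv_eq0 => kle eqk.
  by rewrite -leqn0 -(leq_add2r (\dim (limg f))) eqk.
apply/inj_row_free => v vG0; apply: (lker0P ker0).
by rewrite linear0 lfunE.
Qed.

(* A set Z of more than n - d coordinates determines the words of the code over
   F, i.e. the columns of G in Z have full rank, which extending scalars
   preserves. *)
Lemma row_code_extend_min_dist (L : fieldType) (f : {rmorphism F -> L}) d
    (v : 'rV[L]_k) :
  row_free G -> min_dist_ge (row_code G) d ->
  (#|[set i | (v *m map_mx f G) 0 i != 0]%R| < d)%N -> v = 0.
Proof.
move=> Gfree dG; set Z := ~: [set i | (v *m map_mx f G) 0 i != 0] => wt.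
pose GZ := colsub (@enum_val _ (mem Z)) G.
have GZfree : row_free GZ.
  (* If [u *m G] vanishes on [Z], its support has fewer than [d] coordinates, so the word is
     zero. *)
  apply/inj_row_free => u uGZ0; have uG : u *m G = 0.
    apply/eqP/contraT => ne; have := dG _ _ (mulmx_row_code u) (mem0v _) ne.
    rewrite leqNgt (leq_ltn_trans _ wt) // subset_leq_card //.
    apply/subsetP=> i; rewrite !inE [X in _ != X]mxE; apply: contraNneq => vi0.
    have iZ : i \in Z by rewrite !inE vi0 eqxx.
    have <- : (u *m GZ) 0 (enum_rank_in iZ i) = (u *m G) 0 i.
      by rewrite !mxE; apply: eq_bigr => l _; rewrite !mxE enum_rankK_in.
    by rewrite uGZ0 mxE.
  by apply/(row_free_inj Gfree); rewrite uG mul0mx.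
apply: (@row_free_inj _ 1 _ _ (map_mx f GZ)); first by rewrite row_free_map.
rewrite mul0mx; apply/rowP=> l; rewrite [RHS]mxE.
have := enum_valP l; rewrite !inE negbK => /eqP <-.
by rewrite !mxE; apply: eq_bigr => i _; rewrite !mxE.
Qed.

End RowCode.

(** * Injectivity of the Gabidulin encoding *)

Section Gabidulin.
Variables (F : finFieldType) (L : fieldExtType F).

(** Additivity holds because [#|F|] is a power of the characteristic; scalars come out because
    [b ^+ #|F| = b] in [F]. *)
Lemma Frobenius_linear i (b : F) (u v : L) :
  (b *: u + v) ^+ (#|F| ^ i) = b *: u ^+ (#|F| ^ i) + v ^+ (#|F| ^ i).
Proof.
have [p p_pr pF] := finPcharP F.
rewrite exprDn_pchar; last first.
  rewrite pnatX (card_pprimeChar pF) pnatX; apply/orP; left; apply/orP; left.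
  by rewrite pnatE // pchar_lalg.
rewrite exprZn; congr (_ *: _ + _).
by elim: i => [|i IH]; rewrite ?expr1 // expnSr exprM IH expf_card.
Qed.

Lemma horner_gab_poly k (a : 'rV[L]_k) y :
  (gab_poly a).[y] = \sum_(i < k) a 0 i * y ^+ (#|F| ^ i).
Proof.
by rewrite /gab_poly horner_sum; apply: eq_bigr => i _; rewrite hornerZ hornerXn.
Qed.

Lemma gab_poly_linear k (a : 'rV[L]_k) (b : F) (u v : L) :
  (gab_poly a).[b *: u + v] = b *: (gab_poly a).[u] + (gab_poly a).[v].
Proof.
rewrite !horner_gab_poly scaler_sumr -big_split; apply: eq_bigr => i _ /=.
by rewrite Frobenius_linear mulrDr scalerAr.
Qed.

Lemma gab_poly_lin_comb k (a : 'rV[L]_k) N (y : 'I_N -> L) (c : 'I_N -> F) :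
  (forall i, (gab_poly a).[y i] = 0) ->
  (gab_poly a).[\sum_i c i *: y i] = 0.
Proof.
move=> ay0; elim/big_rec: _ => [|i z _ IH].
  by have := gab_poly_linear a (-1) 0 0; rewrite scaler0 addr0 scaleN1r addNr.
by rewrite gab_poly_linear ay0 IH scaler0 addr0.
Qed.

Lemma size_gab_poly k (a : 'rV[L]_k) : (size (gab_poly a) <= #|F| ^ k)%N.
Proof.
apply: (leq_trans (size_sum _ _ _)); apply/bigmax_leqP => i _.
apply: (leq_trans (size_scale_leq _ _)); rewrite size_polyXn.
by rewrite ltn_exp2l // finRing_gt1.
Qed.

(** The exponents [#|F| ^ i] are distinct since [#|F| > 1], so the message can be read off the
    polynomial. *)
Lemma coef_gab_poly k (a : 'rV[L]_k) (i : 'I_k) :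
  (gab_poly a)`_(#|F| ^ i) = a 0 i.
Proof.
rewrite coef_sum (bigD1 i) //= coefZ coefXn eqxx mulr1 big1 ?addr0 // => j ji.
rewrite coefZ coefXn eqn_exp2l ?finRing_gt1 // [_ == _](negbTE _) ?mulr0 //.
by rewrite eq_sym.
Qed.

(* The polynomial of a vanishes on the F-span of the points, which has
   #|F| ^ N elements, more than its degree. *)
Lemma gab_encode_eq0 N (x : N.-tuple L) (a : 'rV[L]_N) :
  free x -> gab_encode x a = 0 -> a = 0.
Proof.
move=> xfree xa0; have ax0 (i : 'I_N) : (gab_poly a).[tnth x i] = 0.
  by have /rowP/(_ i) := xa0; rewrite !mxE.
pose comb (c : {ffun 'I_N -> F}) := \sum_i c i *: tnth x i.
have comb_inj : injective comb.
  move=> c c' /eqP; rewrite -subr_eq0 /comb -sumrB => /eqP eq0.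
  apply/ffunP=> i; apply/eqP; rewrite -subr_eq0; apply/eqP.
  move: i; apply: (freeP xfree); rewrite -[RHS]eq0.
  by apply: eq_bigr => i _; rewrite (tnth_nth 0) scalerBl.
have a0 : gab_poly a = 0.
  apply/eqP/contraT => ne.
  have := max_poly_roots ne (rs := [seq comb c | c : {ffun 'I_N -> F}]).
  rewrite size_map -cardE card_ffun card_ord ltnNge size_gab_poly; apply.
    by apply/allP=> _ /mapP[c _ ->]; apply/eqP/gab_poly_lin_comb.
  by rewrite map_inj_uniq ?enum_uniq.
by apply/rowP=> i; rewrite -coef_gab_poly a0 coef0 mxE.
Qed.

End Gabidulin.

(** * Information sets and the dimension bound *)

Lemma exists_subset_card (T : finType) (A : {set T}) k :
  exists2 B : {set T}, B \subset A & #|B| = minn k #|A|.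
Proof.
exists [set y in take k (enum A)].
  by apply/subsetP=> y; rewrite inE => /mem_take; rewrite mem_enum.
rewrite cardsE (card_uniqP _) ?take_uniq ?enum_uniq // size_take -cardE.
by rewrite /minn.
Qed.

(** As [C] is linear, this says that words agreeing on [I] agree on [T]; with [T] full, [I] contains
    an information set. *)
Definition determines (K : fieldType) n (C : {vspace 'rV[K]_n})
    (I T : {set 'I_n}) : Prop :=
  forall c, c \in C -> {in I, forall i, c 0 i = 0} -> {in T, forall i, c 0 i = 0}.

Section Determines.
Variables (K : fieldType) (n : nat) (C : {vspace 'rV[K]_n}).

Lemma determines_dim (I : {set 'I_n}) : determines C I setT -> (\dim C <= #|I|)%N.
Proof.
move=> det; set f := linfun (colsub (@enum_val _ (mem I)) : 'rV[K]_n -> _).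
have fE (c : 'rV[K]_n) (l : 'I_#|I|) : f c 0 l = c 0 (enum_val l).
  by rewrite lfunE /= mxE.
rewrite -(limg_dim_eq (f := f)).
  by apply: leq_trans (dimvS (subvf _)) _; rewrite dimvf dim_matrix mul1r.
apply/eqP; rewrite -subv0; apply/subvP=> c; rewrite memv_cap memv_ker memv0.
case/andP=> cC /eqP fc0; apply/eqP/rowP=> i; rewrite [RHS]mxE.
apply: det cC _ _ (in_setT i) => l lI.
by rewrite -(enum_rankK_in lI lI) -fE fc0 mxE.
Qed.

Lemma determines_bigcup s (I T : 'I_s -> {set 'I_n}) :
  (forall j, determines C (I j) (T j)) ->
  determines C (\bigcup_j I j) (\bigcup_j T j).
Proof.
move=> det c cC cI i /bigcupP[j _ iT]; apply: (det j c cC) iT => l lI.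
by apply: cI; apply/bigcupP; exists j.
Qed.

(* A word of C that vanishes on T and off d - 1 points of S has weight less
   than d on S. *)
Lemma determines_local_set d (I T S : {set 'I_n}) :
  (0 < d)%N -> min_dist_ge (restrict_code S C) d -> determines C I T ->
  exists2 I', determines C I' (T :|: S)
    & (#|I'| <= #|I| + (#|S :\: T| - (d - 1)))%N.
Proof.
move=> d0 /min_dist_ge_restrictP dS det.
(* The points of [E] are recovered by the local code; only the other new coordinates join [I]. *)
have [E ED cardE] := exists_subset_card (S :\: T) (d - 1).
exists (I :|: (S :\: T :\: E)).
  move=> c cC cI; have cT : {in T, forall i, c 0 i = 0}.
    by apply: det => // i iI; apply: cI; rewrite inE iI.
  move=> i; rewrite inE => /orP[/cT // | iS]; apply: (dS c cC _ i iS).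
  apply: (@leq_ltn_trans #|E|); last by rewrite cardE; lia.
  apply/subset_leq_card/subsetP=> l; rewrite inE => /andP[lS cl0].
  apply: contraR cl0 => lE; apply/eqP.
  have [/cT // | lT] := boolP (l \in T).
  by apply: cI; rewrite !inE lE lT lS orbT.
apply: leq_trans (leq_card_setU _ _) _; rewrite leq_add2l (cardsDS ED) cardE.
by lia.
Qed.

(* Each step adds D = S :\: T to the determined set, with #|D| <= r + d - 1,
   at the cost of max(0, #|D| - (d - 1)) information coordinates, which is at
   most #|D| * r / (r + d - 1) by convexity. *)
Lemma exists_local_info_set r d (N : {set 'I_n}) :
  (0 < d)%N ->
  (forall i, i \in N -> exists S : {set 'I_n},
     [/\ S \subset N, i \in S, (#|S| <= r + d - 1)%N
       & min_dist_ge (restrict_code S C) d]) ->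
  exists2 I, determines C I N & ((r + d - 1) * #|I| <= r * #|N|)%N.
Proof.
move=> d0 loc.
(* Induction on a bound [k] for the number of coordinates of [N] outside [T]. *)
suff grow k (T I : {set 'I_n}) : (#|N :\: T| <= k)%N -> T \subset N ->
    determines C I T -> ((r + d - 1) * #|I| <= r * #|T|)%N ->
    exists2 I, determines C I N & ((r + d - 1) * #|I| <= r * #|N|)%N.
  apply: (grow _ set0 set0 (leqnn _) (sub0set _)); last by rewrite cards0 muln0.
  by move=> c _ _ i; rewrite inE.
elim: k T I => [|k IH] T I cardNT TN det bound.
  move: cardNT; rewrite leqn0 cards_eq0 setD_eq0 => NT.
  have -> : N = T by apply/eqP; rewrite eqEsubset NT TN.
  by exists I.
have [NT0|[i]] := set_0Vmem (N :\: T).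
  by apply: (IH T I) => //; rewrite NT0 cards0.
rewrite inE => /andP[iT iN]; have [S [SN iS cardS dS]] := loc i iN.
have [I' det' card'] := determines_local_set d0 dS det.
apply: (IH (T :|: S) I') => //; last first.
- have := subset_leq_card (subsetDl S T).
  have -> : #|T :|: S| = (#|T| + #|S :\: T|)%N.
    by rewrite cardsU cardsD setIC addnBA // subset_leq_card ?subsetIl.
  move: card' bound cardS; move: #|S :\: T| #|I'| #|I| #|S| #|T| => D a b e t.
  (* In the first case no coordinate is paid for. In the second, [z = D - (d - 1)] are, and
     [(r + d - 1) * z <= r * D] reduces to [(d - 1) * z <= (d - 1) * r], which follows from
     [z <= r]. *)
  case: (leqP D (d - 1)) => [Dd | dD] ab bt eM De.
    have ab' : (a <= b)%N by lia.
    nia.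
  have [z Dz] : exists z, D = (d - 1 + z)%N by exists (D - (d - 1))%N; lia.
  have [y dy] : exists y, d = y.+1 by exists d.-1; lia.
  subst D d; nia.
- by rewrite subUset TN.
- rewrite -ltnS (leq_trans _ cardNT) //; apply: proper_card; apply/properP.
  split; first by rewrite setDS // subsetUl.
  by exists i; rewrite !inE ?iT ?iS ?orbT ?andbF.
Qed.

End Determines.

(** The remainder is 0, so the first branch applies unless [d = 1], where the second one subtracts
    nothing from [m * r]. *)
Lemma local_dim_dvd m r d : (0 < r)%N -> (0 < d)%N ->
  local_dim (m * (r + d - 1))%N r d = (m * r)%N.
Proof.
move=> r0 d0; have M0 : (0 < r + d - 1)%N by lia.
rewrite /local_dim modnMl mulnK // add0n; case: ifP => // d2.
have -> : d = 1%N by lia.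
by rewrite subnn muln0 subn0 addnK.
Qed.

Lemma locality_dim_le (K : fieldType) n s (N : 'I_s -> {set 'I_n})
    (m r delta : 'I_s -> nat) (C : {vspace 'rV[K]_n}) :
  (forall j, 0 < r j)%N -> (forall j, 0 < delta j)%N ->
  has_locality N (fun j => m j * (r j + delta j - 1))%N r delta C ->
  (\dim C <= \sum_j m j * r j)%N.
Proof.
move=> r0 d0 [cover cardN loc].
have /fin_all_exists2[I det cardI] j := exists_local_info_set (d0 j) (loc j).
have NT : \bigcup_j N j = setT.
  by apply/setP=> i; rewrite inE; have [j [iN _]] := cover i; apply/bigcupP; exists j.
have := determines_bigcup det; rewrite NT => /determines_dim/leq_trans; apply.
apply: (@leq_trans (\sum_j #|I j|)).
  elim/big_rec2: _ => [|j k A _ le]; first by rewrite cards0.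
  by apply: leq_trans (leq_card_setU _ _) _; rewrite leq_add2l.
apply: leq_sum => j _; have M0 : (0 < r j + delta j - 1)%N.
  by have := r0 j; have := d0 j; lia.
(* [#|N j|] is a multiple of [r j + delta j - 1], so this factor cancels without rounding. *)
rewrite -(leq_pmul2l M0) (leq_trans (cardI j)) // cardN.
by rewrite mulnC -mulnA mulnCA.
Qed.

(** * Locality and injectivity of the constructed encoding *)

Section LocallyRepairableCode.
Variables (F : finFieldType) (L : fieldExtType F) (s : nat).
Variables (r delta m : 'I_s -> nat) (k : nat).
Variable x : (\sum_(j < s) m j * r j).-tuple L.
Variable pi : 'S_(\sum_(j < s) m j * r j).
Variable G : forall j : 'I_s, 'I_(m j) -> 'M[F]_(r j, r j + delta j - 1).

Local Notation n_ := (fun j => m j * (r j + delta j - 1))%N.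
Local Notation coord l c := (@tagnat.Rank s n_ _ (mxvec_index l c)).

Lemma lrc_encodeE (a : 'rV[L]_k) j (l : 'I_(m j)) c :
  lrc_encode x pi G a 0 (coord l c) =
  (row l (local_groups pi (gab_encode x a) j) *m map_mx (in_alg L) (G l)) 0 c.
Proof.
transitivity (submxrow (lrc_encode x pi G a) j 0 (mxvec_index l c)).
  by rewrite [RHS]mxE.
by rewrite mxrowK mxvecE mxE.
Qed.

Lemma coord_inj j (l : 'I_(m j)) : injective (fun c => coord l c).
Proof.
move=> c c' /eqP; rewrite -val_eqE tagnat.eq_Rank eqxx /= val_eqE => /eqP.
by move=> /enum_rank_inj[].
Qed.

Lemma coordP j i : i \in block_coords n_ j ->
  exists l : 'I_(m j), exists c, i = coord l c.
Proof.
rewrite inE => /eqP <-; case/mxvec_indexP E : (tagnat.sig2 i) => [l c].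
by exists l, c; rewrite -[LHS]tagnat.sig2K E.
Qed.

Lemma coord_block j (l : 'I_(m j)) c : coord l c \in block_coords n_ j.
Proof. by rewrite inE tagnat.Rank1K. Qed.

Lemma card_block_coords j : #|block_coords n_ j| = n_ j.
Proof.
rewrite -[RHS]card_ord -(card_imset _ (f := @tagnat.Rank s n_ j)); last first.
  by move=> c c' /eqP; rewrite -val_eqE tagnat.eq_Rank eqxx /= val_eqE => /eqP.
apply: eq_card => i; apply/idP/imsetP => [|[c _ ->]].
  rewrite inE => /eqP <-; exists (tagnat.sig2 i) => //.
  by rewrite tagnat.sig2K.
by rewrite inE tagnat.Rank1K.
Qed.

Hypothesis Gfree : forall j (l : 'I_(m j)), row_free (G l).

Lemma lrc_locality :
  (forall j (l : 'I_(m j)), min_dist_ge (row_code (G l)) (delta j)) ->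
  has_locality (block_coords n_) n_ r delta (lrc_code k x pi G).
Proof.
move=> dG; split=> [i|j|j i].
- by exists (tagnat.sig1 i); split=> [|j]; rewrite inE // => /eqP.
- exact: card_block_coords.
(* The recovering set is the whole encoded group containing the coordinate. *)
case/coordP=> l [c ->]; exists [set coord l c' | c' in setT]; split.
- by apply/subsetP=> _ /imsetP[c' _ ->]; apply: coord_block.
- exact: imset_f.
- by rewrite (leq_trans (leq_imset_card _ _)) // cardsT card_ord.
apply/min_dist_ge_restrictP => _ /memv_imgP[a _ ->] wt _ /imsetP[c' _ ->].
move: wt; rewrite !lfunE /= => wt; rewrite lrc_encodeE.
(* A local message over [L] whose encoding has weight below [delta j] is zero. *)
suff -> : row l (local_groups pi (gab_encode x a) j) = 0 by rewrite mul0mx mxE.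
apply: (row_code_extend_min_dist (f := in_alg L) (Gfree l) (dG j l)).
apply: leq_ltn_trans wt; rewrite -(card_imset _ (@coord_inj j l)).
apply/subset_leq_card/subsetP=> _ /imsetP[c'' + ->].
by rewrite !inE lrc_encodeE => ->; rewrite andbT; apply: imset_f.
Qed.

(** The layers are undone in turn: the permutation, the concatenations, and the local encodings,
    injective by [Gfree]. *)
Lemma lrc_encode_eq0 (a : 'rV[L]_k) :
  lrc_encode x pi G a = 0 -> gab_encode x a = 0.
Proof.
move=> a0; suff: col_perm pi (gab_encode x a) = 0.
  move=> /(congr1 (col_perm pi^-1)); rewrite -col_permM mulVg col_perm1 => ->.
  by apply/matrixP=> i j; rewrite !mxE.
apply/mxrowP=> j; apply: (can_inj (@vec_mxK _ _ _)).
apply/row_matrixP=> l.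
have lfree : row_free (map_mx (in_alg L) (G l)) by rewrite row_free_map.
apply: (row_free_inj lfree); apply/rowP=> c.
rewrite -[LHS](lrc_encodeE a) a0 !mxE big1 // => d _.
by rewrite !mxE mul0r.
Qed.

End LocallyRepairableCode.

Theorem mainTheorem4 (F : finFieldType) (L : fieldExtType F) (t s : nat)
    (r delta m : 'I_s -> nat)
    (x : (\sum_(j < s) m j * r j).-tuple L)
    (pi : 'S_(\sum_(j < s) m j * r j))
    (G : forall j : 'I_s, 'I_(m j) -> 'M[F]_(r j, r j + delta j - 1))
    (ht : \dim {:L} = t)
    (hr : forall j, (0 < r j)%N)
    (hdelta : forall j, (0 < delta j)%N)
    (hm : forall j, (0 < m j)%N)
    (hNt : (\sum_(j < s) m j * r j <= t)%N)
    (hx : free x)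
    (hG : forall (j : 'I_s) (l : 'I_(m j)),
        is_MDS (row_code (G j l)) (r j) (delta j)) :
  let n_ := fun j => (m j * (r j + delta j - 1))%N in
  let C := @lrc_code F L s r delta m (\sum_(j < s) m j * r j)%N x pi G in
  [/\ has_locality (block_coords n_) n_ r delta C,
      (\dim C = \sum_(j < s) local_dim (n_ j) (r j) (delta j))%N
    & forall (K : fieldType) (N : 'I_s -> {set 'I_(\sum_(j < s) n_ j)})
        (C' : {vspace 'rV[K]_(\sum_(j < s) n_ j)}),
        has_locality N n_ r delta C' ->
        (\dim C' <= \sum_(j < s) local_dim (n_ j) (r j) (delta j))%N].
Proof.
move=> n_ C.
have Gfree j (l : 'I_(m j)) : row_free (G j l).
  by have [[dimG _] _] := hG j l; apply: row_code_row_free.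
have -> : (\sum_(j < s) local_dim (n_ j) (r j) (delta j) = \sum_j m j * r j)%N.
  by apply: eq_bigr => j _; apply: local_dim_dvd.
split=> [||K N C']; last exact: locality_dim_le.
  by apply: lrc_locality => // j l; have [[_ []]] := hG j l.
(* The message length equals the number of evaluation points, so the Gabidulin encoding is injective
   and the encoder keeps the dimension of the message space. *)
rewrite /C /lrc_code limg_dim_eq ?dimvf ?dim_matrix ?mul1r //.
apply/eqP; rewrite -subv0; apply/subvP=> a; rewrite memv_cap memv_ker memv0.
rewrite lfunE /= => /andP[_ /eqP/(lrc_encode_eq0 Gfree) a0].
by apply/eqP/(gab_encode_eq0 hx).
Qed.
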